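(* Let $X$ and $Y$ be two compactly generated (Hausdorff) topological spaces. The functor $\mathrm{Glob}(-)$ induces a bijection of sets $[X,Y]\cong[\mathrm{Glob}(X),\mathrm{Glob}(Y)]_S$.
   Context: For a topological space $X$, $\mathrm{Glob}(X)$ is the quotient of $X\times[0,1]$ by $(x,0)=(x',0)$ and $(x,1)=(x',1)$ for all $x,x'\in X$; the class of $(x,0)$ is $\underline\iota$ and that of $(x,1)$ is $\underline\sigma$. It is partially ordered by the image of $\{((x,t),(x,t')) : t\le t'\}$. For continuous $g:X\to Y$, $\mathrm{Glob}(g)(x,t)=(g(x),t)$. A non-constant execution path of $\mathrm{Glob}(X)$ is a continuous non-decreasing map $\gamma:[0,1]\to\mathrm{Glob}(X)$ with $\gamma(0)=\underline\iota$ and $\gamma(1)=\underline\sigma$. A morphism of globular complexes $f:\mathrm{Glob}(X)\to\mathrm{Glob}(Y)$ is a continuous map with $f(\{\underline\iota,\underline\sigma\})\subset\{\underline\iota,\underline\sigma\}$ such that $f\circ\gamma$ is a non-constant execution path of $\mathrm{Glob}(Y)$ for every non-constant execution path $\gamma$ of $\mathrm{Glob}(X)$. Two such morphisms $f,g$ are S-homotopic if there is a continuous map $H:\mathrm{Glob}(X)\times[0,1]\to\mathrm{Glob}(Y)$ with $H(-,0)=f$, $H(-,1)=g$ and each $H(-,u)$ a morphism of globular complexes. This is an equivalence relation; $[\mathrm{Glob}(X),\mathrm{Glob}(Y)]_S$ is the set of S-homotopy classes of morphisms. $[X,Y]$ is the set of homotopy classes of continuous maps $X\to Y$. A Hausdorff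 space is compactly generated when its topology is the weak topology determined by its compact subspaces. *)

(* Defs.v *)
From HB Require Import structures.
From mathcomp Require Import all_boot all_order all_algebra.
From mathcomp Require Import generic_quotient.
From mathcomp Require Import all_classical all_reals all_analysis.
Import Order.TTheory GRing.Theory Num.Theory.
Import numFieldNormedType.Exports.

Set Implicit Arguments.
Unset Strict Implicit.
Unset Printing Implicit Defensive.

Local Open Scope classical_set_scope.
Local Open Scope ring_scope.
Local Open Scope quotient_scope.

(* Closedness is tested in the subspace topology of each compact [K]. *)
Definition compactly_generated (X : topologicalType) : Prop :=
  hausdorff_space X /\
  forall A : set X,
    (forall K : set X, compact K -> closed (A : set (subspace K))) -> closed A.

(* Used as a type, a set denotes [set_type], which carries the subset
   topology. *)
Definition unitI (R : realType) : set R := `[0, 1].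
Arguments unitI : clear implicits.

Section unit_interval.
Context {R : realType}.
Local Notation I := (set_type (unitI R)).

Definition unitI_val (t : I) : R := \val t.

Lemma unitI_val_inj : injective unitI_val.
Proof. exact: val_inj. Qed.

Lemma unitI_itv (t : I) : 0 <= unitI_val t <= 1.
Proof. by move: (set_valP t); rewrite /unitI /mkset in_itv. Qed.

Lemma unitI_val_continuous : continuous unitI_val.
Proof. exact: initial_continuous. Qed.

Lemma clamp_subproof (t : R) :
  Num.max 0 (Num.min t 1) \in unitI R.
Proof.
apply/mem_set; rewrite /unitI /mkset in_itv /= le_max lexx /= ge_max ler01 /=.
by rewrite ge_min lexx orbT.
Qed.

Definition clamp (t : R) : I := exist (fun x => x \in unitI R) _ (clamp_subproof t).

Lemma clampE (t : R) : 0 <= t <= 1 -> unitI_val (clamp t) = t.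
Proof.
move=> /andP[t0 t1]; rewrite /unitI_val /=.
by rewrite (min_idPl t1) (max_idPr t0).
Qed.

Lemma unitI_valK : cancel unitI_val clamp.
Proof.
by move=> t; apply: unitI_val_inj; rewrite clampE// unitI_itv.
Qed.

Lemma clamp_continuous : continuous clamp.
Proof.
apply: continuous_comp_initial.
apply: (@max_fun_continuous _ R R (cst 0) (fun t => Num.min t 1)).
  by move=> t; exact: cvg_cst.
apply: (@min_fun_continuous _ R R id (cst 1)).
  by move=> t; exact: cvg_id.
by move=> t; exact: cvg_cst.
Qed.

Definition unitI0 : I := clamp 0.
Definition unitI1 : I := clamp 1.

Lemma unitI0E : unitI_val unitI0 = 0.
Proof. by rewrite clampE// lexx ler01. Qed.

Lemma unitI1E : unitI_val unitI1 = 1.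
Proof. by rewrite clampE// lexx ler01. Qed.

Lemma unitI01 : unitI0 != unitI1.
Proof.
apply/negP => /eqP /(congr1 unitI_val); rewrite unitI0E unitI1E => /eqP.
by rewrite eq_sym oner_eq0.
Qed.

End unit_interval.

Section homotopy.
Context {R : realType} {Z W : topologicalType}.
Local Notation I := (set_type (unitI R)).

Definition homotopic_through (P : set (Z -> W)) (f g : Z -> W) : Prop :=
  exists H : Z * I -> W,
    [/\ continuous H,
        (forall z, H (z, unitI0) = f z),
        (forall z, H (z, unitI1) = g z) &
        forall u : I, P (fun z => H (z, u))].

Lemma slice_continuous (F : Z * I -> W) (phi : Z * I -> I) :
  continuous F -> continuous phi -> continuous (fun p => F (p.1, phi p)).
Proof.
move=> cF cphi p.
apply: (@continuous_comp _ _ _ (fun p : Z * I => (p.1, phi p)) F);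
  last exact: cF.
apply: (@cvg_pair _ _ _ (nbhs p) (nbhs p.1) (nbhs (phi p))).
  exact: cvg_fst.
exact: cphi.
Qed.

Lemma homotopic_through_refl (P : set (Z -> W)) (f : Z -> W) :
  continuous f -> P f -> homotopic_through P f f.
Proof.
move=> cf Pf; exists (f \o fst); split => // p.
by apply: continuous_comp; [exact: cvg_fst|exact: cf].
Qed.

Lemma reparam_continuous (c : R -> R) : continuous c ->
  continuous (fun p : Z * I => clamp (c (unitI_val p.2))).
Proof.
move=> cc p; apply: (@continuous_comp _ _ _ snd
  (fun u : I => clamp (c (unitI_val u)))); first exact: cvg_snd.
apply: (@continuous_comp _ _ _ unitI_val (clamp \o c)).
  exact: unitI_val_continuous.
by apply: continuous_comp; [exact: cc|exact: clamp_continuous].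
Qed.

Lemma homotopic_through_sym (P : set (Z -> W)) (f g : Z -> W) :
  homotopic_through P f g -> homotopic_through P g f.
Proof.
move=> [H [cH H0 H1 PH]].
exists (fun p => H (p.1, clamp (1 - unitI_val p.2))); split => [|z|z|u].
- apply: slice_continuous => //; apply: (@reparam_continuous (fun t => 1 - t)).
  by move=> t; apply: cvgB; [exact: cvg_cst|exact: cvg_id].
- by rewrite /= unitI0E subr0 H1.
- by rewrite /= unitI1E subrr H0.
- exact: (PH (clamp (1 - unitI_val u))).
Qed.

Lemma glue_continuous (F G : Z * I -> W) (c : R) :
  continuous F -> continuous G ->
  (forall p, unitI_val p.2 = c -> F p = G p) ->
  continuous (fun p => if unitI_val p.2 <= c then F p else G p).
Proof.
move=> cF cG FG p.
have cv : (fun q : Z * I => unitI_val q.2) @ p --> unitI_val p.2.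
  apply: (@continuous_comp _ _ _ snd unitI_val); first exact: cvg_snd.
  exact: unitI_val_continuous.
move=> V /=.
have nF : nbhs (F p) V -> \forall q \near p, V (F q) := cF p V.
have nG : nbhs (G p) V -> \forall q \near p, V (G q) := cG p V.
case: (ltgtP (unitI_val p.2) c) => [pc|pc|pc] nV.
- have nc : \forall q \near p, unitI_val q.2 < c := cv _ (lt_nbhsl pc).
  apply: filterS (filterI nc (nF nV)) => q [/= qc Vq].
  by rewrite (ltW qc).
- have nc : \forall q \near p, c < unitI_val q.2 := cv _ (lt_nbhsr pc).
  apply: filterS (filterI nc (nG nV)) => q [/= qc Vq].
  by rewrite leNgt qc.
- have nV' := nV; rewrite FG// in nV'.
  apply: filterS (filterI (nF nV) (nG nV')) => q [/= Fq Gq].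
  by case: ifP.
Qed.

Lemma homotopic_through_trans (P : set (Z -> W)) (f g h : Z -> W) :
  homotopic_through P f g -> homotopic_through P g h ->
  homotopic_through P f h.
Proof.
move=> [F [cF F0 F1 PF]] [G [cG G0 G1 PG]].
exists (fun p => if unitI_val p.2 <= 2^-1
  then F (p.1, clamp (2 * unitI_val p.2))
  else G (p.1, clamp (2 * unitI_val p.2 - 1))).
have c2 : continuous (fun t : R => 2 * t).
  by move=> t; apply: cvgM; [exact: cvg_cst|exact: cvg_id].
split => [|z|z|u].
- apply: glue_continuous.
  + by apply: slice_continuous => //; exact: reparam_continuous.
  + apply: slice_continuous => //.
    apply: (@reparam_continuous (fun t => 2 * t - 1)).
    by move=> t; apply: cvgB; [exact: c2|exact: cvg_cst].
  + by move=> [z u] /= ->; rewrite mulfV// subrr F1 G0.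
- by rewrite /= unitI0E invr_ge0 ler0n mulr0 F0.
- rewrite /= unitI1E invf_ge1// (_ : (2 <= 1 :> R) = false); last first.
    by rewrite lern1.
  by rewrite mulr1 -addrA (_ : 1 + (1 - 1) = 1 :> R) ?G1// subrr addr0.
- rewrite /=; case: (unitI_val u <= 2^-1); [exact: (PF (clamp _))|exact: (PG (clamp _))].
Qed.

End homotopy.
Arguments homotopic_through R {Z W}.

Section homotopy_classes.
Variables (R : realType) (X Y : topologicalType).

Definition homotopic (f g : continuousType X Y) : Prop :=
  homotopic_through R setT f g.

Local Lemma homotopic_refl : reflexive (fun f g => `[< homotopic f g >]).
Proof.
move=> f; apply/asboolP; apply: homotopic_through_refl => //.
exact: cts_fun.
Qed.

Local Lemma homotopic_sym : symmetric (fun f g => `[< homotopic f g >]).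
Proof.
by move=> f g; apply/asboolP/asboolP; exact: homotopic_through_sym.
Qed.

Local Lemma homotopic_trans : transitive (fun f g => `[< homotopic f g >]).
Proof.
move=> g f h /asboolP fg /asboolP gh; apply/asboolP.
exact: homotopic_through_trans fg gh.
Qed.

Definition homotopic_equiv :=
  EquivRel _ homotopic_refl homotopic_sym homotopic_trans.

Definition homotopy_class := {eq_quot homotopic_equiv}.

HB.instance Definition _ := Quotient.on homotopy_class.

End homotopy_classes.

Section globe.
Variables (R : realType) (X : topologicalType).
Local Notation I := (set_type (unitI R)).

Definition glob_rel' (p q : X * I) : bool :=
  [|| p == q, (p.2 == unitI0) && (q.2 == unitI0) |
      (p.2 == unitI1) && (q.2 == unitI1)].

Local Lemma glob_rel_refl : reflexive glob_rel'.
Proof. by move=> p; rewrite /glob_rel' eqxx. Qed.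

Local Lemma glob_rel_sym : symmetric glob_rel'.
Proof.
by move=> p q; rewrite /glob_rel' eq_sym (andbC (p.2 == unitI0))
  (andbC (p.2 == unitI1)).
Qed.

Local Lemma glob_rel_trans : transitive glob_rel'.
Proof.
move=> q p r; rewrite /glob_rel' => /predU1P[->//|pq] /predU1P[<-|qr].
  by rewrite pq orbT.
apply/orP; right; move: pq qr.
case/orP => /andP[-> /eqP ->]; rewrite eqxx /=.
  by rewrite (negbTE unitI01) orbF => ->.
by rewrite eq_sym (negbTE unitI01) /= => ->; rewrite orbT.
Qed.

Definition glob_rel := EquivRel _ glob_rel_refl glob_rel_sym glob_rel_trans.

Definition Glob := {eq_quot glob_rel}.

HB.instance Definition _ := Topological.copy Glob (quotient_topology Glob).
HB.instance Definition _ := Quotient.on Glob.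

Definition glob_pt (x : X) (t : I) : Glob := \pi_Glob (x, t).

(* When [X] is empty so is [Glob], and the two poles do not exist; they are
   therefore represented by the sets of points equal to them, each of which
   has exactly one element when [X] is nonempty. *)
Definition glob_iota : set Glob := [set glob_pt x unitI0 | x in setT].
Definition glob_sigma : set Glob := [set glob_pt x unitI1 | x in setT].

Definition glob_le (z z' : Glob) : Prop :=
  exists x (t t' : I), [/\ unitI_val t <= unitI_val t',
    z = glob_pt x t & z' = glob_pt x t'].

Definition exec_path (gamma : I -> Glob) : Prop :=
  [/\ continuous gamma,
      (forall t t' : I, unitI_val t <= unitI_val t' ->
         glob_le (gamma t) (gamma t')),
      glob_iota (gamma unitI0) &
      glob_sigma (gamma unitI1)].

Lemma glob_ptP (x x' : X) (t t' : I) :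
  glob_pt x t = glob_pt x' t' <->
  [\/ x = x' /\ t = t', t = unitI0 /\ t' = unitI0 |
      t = unitI1 /\ t' = unitI1].
Proof.
split.
  move=> /eqmodP /or3P[/eqP[-> ->]|/andP[/eqP/= -> /eqP/= ->]|
    /andP[/eqP/= -> /eqP/= ->]]; by [apply: Or31|apply: Or32|apply: Or33].
case=> [[-> ->]//|[-> ->]|[-> ->]]; apply/eqmodP; rewrite /= /glob_rel'/=.
  by rewrite eqxx orbT.
by rewrite eqxx !orbT.
Qed.

Lemma glob_ptE (z : Glob) : z = glob_pt (repr z).1 (repr z).2.
Proof. by rewrite /glob_pt -surjective_pairing reprK. Qed.

Lemma glob_pt_height (x x' : X) (t t' : I) :
  glob_pt x t = glob_pt x' t' -> t = t'.
Proof. by case/glob_ptP => [[_ ->]|[-> ->]|[-> ->]]. Qed.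

Lemma glob_le_refl (z : Glob) : glob_le z z.
Proof.
by rewrite (glob_ptE z); exists (repr z).1, (repr z).2, (repr z).2.
Qed.

Lemma glob_le_anti (z z' : Glob) : glob_le z z' -> glob_le z' z -> z = z'.
Proof.
move=> [x [t [t' [tt' -> ->]]]] [y [s [s' [ss' zs zt]]]].
suff -> : t = t' by [].
apply: unitI_val_inj; apply/eqP; rewrite eq_le tt' /=.
by rewrite (glob_pt_height zs) (glob_pt_height zt).
Qed.

Lemma glob_le_trans (z1 z2 z3 : Glob) :
  glob_le z1 z2 -> glob_le z2 z3 -> glob_le z1 z3.
Proof.
move=> [x [t1 [t2 [t12 -> ->]]]] [y [s2 [s3 [s23 zs ->]]]].
have t2s2 := glob_pt_height zs; subst s2; have t13 := le_trans t12 s23.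
case/glob_ptP: zs => [[<- _]|[t2E _]|[t2E _]].
- by exists x, t1, s3.
- have t1E : t1 = unitI0.
    apply: unitI_val_inj; move: t12; rewrite t2E unitI0E => t1le.
    by apply/eqP; rewrite eq_le t1le; have /andP[] := unitI_itv t1.
  by exists y, t1, s3; split=> //; apply/glob_ptP; apply: Or32.
- have s3E : s3 = unitI1.
    apply: unitI_val_inj; move: s23; rewrite t2E unitI1E => s3ge.
    by apply/eqP; rewrite eq_le s3ge andbT; have /andP[] := unitI_itv s3.
  by exists x, t1, s3; split=> //; apply/glob_ptP; apply: Or33.
Qed.

End globe.
Arguments glob_pt R {X}.
Arguments glob_iota : clear implicits.
Arguments glob_sigma : clear implicits.

Section globular_morphisms.
Variable R : realType.
Local Notation I := (set_type (unitI R)).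

Definition is_glob_morphism (X Y : topologicalType) (f : Glob R X -> Glob R Y)
  : Prop :=
  [/\ continuous f,
      f @` (glob_iota R X `|` glob_sigma R X)
        `<=` glob_iota R Y `|` glob_sigma R Y &
      forall gamma : I -> Glob R X, exec_path gamma -> exec_path (f \o gamma)].

Record glob_morphism (X Y : topologicalType) := GlobMorphism {
  glob_morphism_fun :> Glob R X -> Glob R Y;
  glob_morphismP : is_glob_morphism glob_morphism_fun }.

HB.instance Definition _ (X Y : topologicalType) :=
  gen_eqMixin (glob_morphism X Y).
HB.instance Definition _ (X Y : topologicalType) :=
  gen_choiceMixin (glob_morphism X Y).

Definition glob_map (X Y : topologicalType) (g : X -> Y) (z : Glob R X)
  : Glob R Y := glob_pt R (g (repr z).1) (repr z).2.

Lemma glob_mapE (X Y : topologicalType) (g : X -> Y) (x : X) (t : I) :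
  glob_map g (glob_pt R x t) = glob_pt R (g x) t.
Proof.
rewrite /glob_map; have := glob_ptE (glob_pt R x t).
case/glob_ptP => [[<- <-]//|[tE rE]|[tE rE]]; apply/glob_ptP.
  by apply: Or32; rewrite rE.
by apply: Or33; rewrite rE.
Qed.

Lemma glob_map_continuous (X Y : topologicalType) (g : continuousType X Y) :
  continuous (glob_map g).
Proof.
apply/quotient_continuous.
rewrite (_ : _ \o _ = \pi_(Glob R Y) \o (fun p => (g p.1, p.2))); last first.
  by apply/funext => -[x t]; exact: glob_mapE.
move=> p; apply: continuous_comp; last exact: pi_continuous.
apply: (@cvg_pair _ _ _ (nbhs p) (nbhs (g p.1)) (nbhs p.2)).
  by apply: continuous_comp; [exact: cvg_fst|exact: cts_fun].
exact: cvg_snd.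
Qed.

Lemma glob_map_morphism (X Y : topologicalType) (g : continuousType X Y) :
  is_glob_morphism (glob_map g).
Proof.
have giota z : glob_iota R X z -> glob_iota R Y (glob_map g z).
  by move=> [x _ <-]; rewrite glob_mapE; exists (g x).
have gsigma z : glob_sigma R X z -> glob_sigma R Y (glob_map g z).
  by move=> [x _ <-]; rewrite glob_mapE; exists (g x).
split; first exact: glob_map_continuous.
  by move=> _ [z [/giota ?|/gsigma ?] <-]; [left|right].
move=> gamma [cgamma mgamma gamma0 gamma1]; split.
- by move=> t; apply: continuous_comp;
    [exact: cgamma|exact: glob_map_continuous].
- move=> t t' /mgamma[x [s [s' [ss' /= -> ->]]]].
  by rewrite !glob_mapE; exists (g x), s, s'.
- exact: giota.
- exact: gsigma.
Qed.

Definition glob_mor (X Y : topologicalType) (g : continuousType X Y) :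
  glob_morphism X Y := GlobMorphism (glob_map_morphism g).

Variables X Y : topologicalType.

Definition S_homotopic (f g : glob_morphism X Y) : Prop :=
  homotopic_through R [set h | is_glob_morphism h] f g.

Local Lemma S_homotopic_refl : reflexive (fun f g => `[< S_homotopic f g >]).
Proof.
move=> f; apply/asboolP; apply: homotopic_through_refl.
  by case: (glob_morphismP f).
exact: glob_morphismP.
Qed.

Local Lemma S_homotopic_sym : symmetric (fun f g => `[< S_homotopic f g >]).
Proof.
by move=> f g; apply/asboolP/asboolP; exact: homotopic_through_sym.
Qed.

Local Lemma S_homotopic_trans : transitive (fun f g => `[< S_homotopic f g >]).
Proof.
move=> g f h /asboolP fg /asboolP gh; apply/asboolP.
exact: homotopic_through_trans fg gh.
Qed.

Definition S_homotopic_equiv :=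
  EquivRel _ S_homotopic_refl S_homotopic_sym S_homotopic_trans.

Definition S_homotopy_class := {eq_quot S_homotopic_equiv}.

HB.instance Definition _ := Quotient.on S_homotopy_class.

End globular_morphisms.
Arguments glob_mor R {X Y}.

(* Main.v *)
Require Import Defs.
From HB Require Import structures.
From mathcomp Require Import all_boot all_order all_algebra.
From mathcomp Require Import generic_quotient.
From mathcomp Require Import all_classical all_reals all_analysis.
Import Order.TTheory GRing.Theory Num.Theory.
Import numFieldNormedType.Exports.

Set Implicit Arguments.
Unset Strict Implicit.
Unset Printing Implicit Defensive.

Local Open Scope classical_set_scope.
Local Open Scope ring_scope.
Local Open Scope quotient_scope.

(* By the intermediate value theorem, every execution path of [Glob Y] passes
   through height 1/2, and monotonicity then confines it to a single column
   [{y} x [0, 1]]. So a morphism [f] of globes has the form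
   [f (x, t) = (g x, h x t)] with [h x] non-decreasing from 0 to 1; [g] is
   continuous because it can be read off locally at a fixed [t] where [f] avoids
   the poles. Interpolating linearly between [t] and [h x t] gives an S-homotopy
   from [Glob g] to [f]. Reading off columns of an S-homotopy between [Glob g]
   and [Glob g'] in the same way, with [X x [0, 1]] as parameter space, gives a
   homotopy from [g] to [g']. *)

(** * Maps into a product, and out of a quotient times a locally compact space *)

Lemma continuous_pair (T U V : topologicalType) (f : T -> U) (g : T -> V)
    (x : T) :
  {for x, continuous f} -> {for x, continuous g} ->
  {for x, continuous (fun y => (f y, g y))}.
Proof. exact: (@cvg_pair _ _ _ (nbhs x) (nbhs (f x)) (nbhs (g x))). Qed.

Section quotient_product.
Import ArrowAsCompactOpen.

(* Currying moves the locally compact factor to the codomain, where the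
   universal property of the quotient applies. *)
Lemma quotient_prod_continuous (T V W : topologicalType) (Q : quotType T)
    (G : quotient_topology Q * V -> W) :
  locally_compact [set: V] -> hausdorff_space V ->
  continuous (fun p : T * V => G (\pi_(quotient_topology Q) p.1, p.2)) ->
  continuous G.
Proof.
move=> lcV hV cG; rewrite -(curryK G).
apply: continuous_uncurry => //.
  apply/quotient_continuous.
  exact: (continuous_curry_fun cG).
move=> z; rewrite -[z]reprK.
exact: (continuous_curry cG).2.
Qed.

End quotient_product.

(** * Topology of the unit interval *)

Section interval.
Context {R : realType}.
Local Notation I := (set_type (unitI R)).

Lemma unitI_compact : compact [set: I].
Proof.
rewrite (_ : setT = clamp @` `[0, 1]%classic); last first.
  apply/seteqP; split => // t _; exists (unitI_val t); last exact: unitI_valK.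
  by rewrite /= in_itv /=; exact: unitI_itv.
apply: continuous_compact; last exact: segment_compact.
by apply: continuous_subspaceT; exact: clamp_continuous.
Qed.

(** Together with [unitI_hausdorff], this lets the homotopy parameter serve as the factor [V] of
    [quotient_prod_continuous]. *)
Lemma unitI_locally_compact : locally_compact [set: I].
Proof.
move=> t _; exists setT; first exact: filterT.
by split; [exact: unitI_compact|exact: closedT].
Qed.

Lemma unitI_hausdorff : hausdorff_space I.
Proof.
move=> s t st; apply: unitI_val_inj; apply: (@order_hausdorff _ R).
move=> A B sA tB.
have [u [Au Bu]] := st _ _ (unitI_val_continuous sA) (unitI_val_continuous tB).
by exists (unitI_val u).
Qed.

End interval.

(** * Coordinates on the globe *)

Section height_base.
Context {R : realType} {X : topologicalType}.
Local Notation I := (set_type (unitI R)).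

Definition glob_height (z : Glob R X) : I := (repr z).2.

(* At the poles this is a junk value: the first coordinate of the chosen
   representative. *)
Definition glob_base (z : Glob R X) : X := (repr z).1.

Lemma glob_heightE (x : X) (t : I) : glob_height (glob_pt R x t) = t.
Proof. by apply/esym/glob_pt_height; exact: glob_ptE. Qed.

Lemma glob_baseE (x : X) (t : I) :
  0 < unitI_val t < 1 -> glob_base (glob_pt R x t) = x.
Proof.
move=> t01; have /glob_ptP[[]//|[t0]|[t1]] := glob_ptE (glob_pt R x t).
  by move: t01; rewrite t0 unitI0E ltxx.
by move: t01; rewrite t1 unitI1E ltxx andbF.
Qed.

Lemma glob_height_continuous : continuous glob_height.
Proof.
apply/quotient_continuous; rewrite (_ : _ \o _ = snd).
  by move=> p; exact: cvg_snd.
by apply/funext => -[x t]; exact: glob_heightE.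
Qed.

Lemma glob_base_continuous (z : Glob R X) :
  0 < unitI_val (glob_height z) < 1 -> {for z, continuous glob_base}.
Proof.
move=> z01 V; rewrite /= nbhsE => -[A [oA Az] AV].
(* The height condition keeps [U] away from the poles and their junk bases, so its preimage in
   [X * I] is the product of [A] with an open interval. *)
pose U := [set w | 0 < unitI_val (glob_height w) < 1 /\ A (glob_base w)].
suff oU : open U.
  by apply: filterS (open_nbhs_nbhs (conj oU (conj z01 Az))) => w [_ /AV].
rewrite /open /= /quotient_open.
rewrite (_ : _ @^-1` _ =
   (unitI_val \o snd) @^-1` `]0, 1[%classic `&` fst @^-1` A); last first.
  apply/seteqP; split => -[x t]; rewrite /U /= in_itv /= glob_heightE.
    by move=> [t01]; rewrite (glob_baseE _ t01).
  by move=> [t01]; split => //; rewrite (glob_baseE _ t01).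
apply: openI; apply: open_comp => //.
- move=> p _; apply: continuous_comp; first exact: cvg_snd.
  exact: unitI_val_continuous.
- by move=> p _; exact: cvg_fst.
Qed.

End height_base.

(** * Execution paths stay in one column *)

Section columns.
Context {R : realType} {Y : topologicalType}.
Local Notation I := (set_type (unitI R)).

Lemma half01 : 0 < (2^-1 : R) < 1.
Proof. by rewrite invr_gt0 ltr0n invf_lt1// ltr1n. Qed.

Lemma exec_path_mid (delta : I -> Glob R Y) : exec_path delta ->
  exists t, unitI_val (glob_height (delta t)) = 2^-1.
Proof.
move=> [cd _ [y0 _ d0] [y1 _ d1]].
(* Precomposing with [clamp] extends the height to all of [R], where [IVT] applies. *)
pose h := unitI_val \o glob_height \o delta \o clamp : R -> R.
have ch : continuous h.
  move=> s; apply: continuous_comp; first exact: clamp_continuous.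
  apply: continuous_comp; first exact: cd.
  by apply: continuous_comp;
    [exact: glob_height_continuous|exact: unitI_val_continuous].
have h0 : h 0 = 0 by rewrite /h /= -/unitI0 -d0 glob_heightE unitI0E.
have h1 : h 1 = 1 by rewrite /h /= -/unitI1 -d1 glob_heightE unitI1E.
have [||s _ hs] := @IVT R h 0 1 2^-1 ler01.
- exact: continuous_subspaceT.
- rewrite h0 h1 (min_idPl ler01) (max_idPr ler01) invr_ge0 ler0n /=.
  by rewrite invf_le1// ler1n.
- by exists (clamp s).
Qed.

(* Two comparable points of height in ]0, 1[ share their base. *)
Lemma exec_path_column (delta : I -> Glob R Y) (t0 : I) :
  exec_path delta -> 0 < unitI_val (glob_height (delta t0)) < 1 ->
  forall t, delta t = glob_pt R (glob_base (delta t0)) (glob_height (delta t)).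
Proof.
move=> [_ md _ _] t01 t.
have [tt0|/ltW t0t] := leP (unitI_val t) (unitI_val t0).
  have [y [s [s' [_ -> dt0]]]] := md _ _ tt0.
  by move: t01; rewrite dt0 !glob_heightE => ?; rewrite glob_baseE.
have [y [s [s' [_ dt0 ->]]]] := md _ _ t0t.
by move: t01; rewrite dt0 !glob_heightE => ?; rewrite glob_baseE.
Qed.

(** Used with [Z] equal to [X] for a single morphism, and to [X * I] for an S-homotopy. *)
Lemma exec_path_family_column (Z : topologicalType) (F : Z * I -> Glob R Y) :
  continuous F -> (forall z, exec_path (fun t => F (z, t))) ->
  exists2 g : Z -> Y, continuous g &
    forall z t, F (z, t) = glob_pt R (g z) (glob_height (F (z, t))).
Proof.
move=> cF eF.
(* The crossing time [m] is merely chosen and may jump with [z]; the base it yields does not depend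
   on which interior time is used. *)
have /choice[m mE] : forall z, exists t,
    unitI_val (glob_height (F (z, t))) = 2^-1.
  by move=> z; exact: exec_path_mid (eF z).
have m01 z : 0 < unitI_val (glob_height (F (z, m z))) < 1.
  by rewrite mE half01.
have FE z := exec_path_column (eF z) (m01 z).
exists (fun z => glob_base (F (z, m z))) => // z0.
(* Near [z0] the value at the fixed time [m z0] stays off the poles, so the
   base may be read there. *)
have cFm : {for z0, continuous (fun z => F (z, m z0))}.
  apply: (@continuous_comp _ _ _ (fun z => (z, m z0)) F); last exact: cF.
  by apply: continuous_pair; [exact: cvg_id|exact: cvg_cst].
have near01 : \forall z \near z0,
    0 < unitI_val (glob_height (F (z, m z0))) < 1.
  have ch : {for z0, continuous
      (unitI_val \o glob_height \o (fun z => F (z, m z0)))}.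
    apply: continuous_comp; first exact: cFm.
    by apply: continuous_comp;
      [exact: glob_height_continuous|exact: unitI_val_continuous].
  have nO : nbhs (unitI_val (glob_height (F (z0, m z0)))) `]0, 1[%classic.
    apply: open_nbhs_nbhs; split; first exact: itv_open.
    by rewrite /= in_itv /= m01.
  have nz : \forall z \near z0,
      `]0, 1[%classic (unitI_val (glob_height (F (z, m z0)))) := ch _ nO.
  by apply: filterS nz => z; rewrite /= in_itv.
have cb : {for z0, continuous (fun z => glob_base (F (z, m z0)))}.
  by apply: continuous_comp; [exact: cFm|exact: glob_base_continuous].
move=> V nV.
have nb : \forall z \near z0, V (glob_base (F (z, m z0))) := cb _ nV.
apply: filterS (filterI near01 nb) => z /= [z01].
by rewrite (FE z (m z0)) glob_baseE.
Qed.

End columns.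

(** * Morphisms of globes and their S-homotopies *)

Section morphisms.
Context {R : realType} {X Y : topologicalType}.
Local Notation I := (set_type (unitI R)).

Lemma column_exec_path (x : X) : exec_path (glob_pt R x).
Proof.
split.
- move=> t; apply: (@continuous_comp _ _ _ (fun t : I => (x, t))).
    by apply: continuous_pair; [exact: cst_continuous|exact: cvg_id].
  exact: pi_continuous.
- by move=> t t' tt'; exists x, t, t'.
- by exists x.
- by exists x.
Qed.

(** The order of a globe only relates points of a common column, so a map that is monotone from
    column to column and fixes the end heights preserves execution paths. *)
Lemma column_morphism (f : Glob R X -> Glob R Y) (g : X -> Y)
    (k : X -> I -> I) :
  continuous f -> (forall x t, f (glob_pt R x t) = glob_pt R (g x) (k x t)) ->
  (forall x, k x unitI0 = unitI0) -> (forall x, k x unitI1 = unitI1) ->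
  (forall x t t', unitI_val t <= unitI_val t' ->
    unitI_val (k x t) <= unitI_val (k x t')) ->
  is_glob_morphism f.
Proof.
move=> cf fE k0 k1 km.
have fiota z : glob_iota R X z -> glob_iota R Y (f z).
  by move=> [x _ <-]; rewrite fE k0; exists (g x).
have fsigma z : glob_sigma R X z -> glob_sigma R Y (f z).
  by move=> [x _ <-]; rewrite fE k1; exists (g x).
split => //; first by move=> _ [z [/fiota ?|/fsigma ?] <-]; [left|right].
move=> gamma [cgamma mgamma gamma0 gamma1]; split.
- by move=> t; apply: continuous_comp; [exact: cgamma|exact: cf].
- move=> t t' /mgamma[x [s [s' [ss' /= -> ->]]]].
  by rewrite !fE; exists (g x), (k x s), (k x s'); split => //; exact: km.
- exact: fiota.
- exact: fsigma.
Qed.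

(** Builds both kinds of S-homotopy below: one moves the base at fixed height, the other moves the
    height over a fixed base. *)
Lemma column_homotopy (G : X * I -> Y) (k : X * I * I -> I) :
  continuous G -> continuous k ->
  (forall x u, k (x, unitI0, u) = unitI0) ->
  (forall x u, k (x, unitI1, u) = unitI1) ->
  (forall x u t t', unitI_val t <= unitI_val t' ->
    unitI_val (k (x, t, u)) <= unitI_val (k (x, t', u))) ->
  exists H : Glob R X * I -> Glob R Y,
    [/\ continuous H,
      forall x t u, H (glob_pt R x t, u) = glob_pt R (G (x, u)) (k (x, t, u)) &
      forall u, is_glob_morphism (fun z => H (z, u))].
Proof.
move=> cG ck k0 k1 km.
pose H (p : Glob R X * I) :=
  glob_pt R (G ((repr p.1).1, p.2)) (k (repr p.1, p.2)).
(* At a pole the representative may have any base, but [k0] and [k1] send it to a pole again, where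
   the base is irrelevant. *)
have HE x t u : H (glob_pt R x t, u) = glob_pt R (G (x, u)) (k (x, t, u)).
  rewrite /H /=; have := glob_ptE (glob_pt R x t).
  case: (repr _) => x' t' /= /glob_ptP[[<- <-]//|[-> ->]|[-> ->]].
    by rewrite !k0; apply/glob_ptP; apply: Or32.
  by rewrite !k1; apply/glob_ptP; apply: Or33.
have cH : continuous H.
  apply: quotient_prod_continuous;
    [exact: unitI_locally_compact|exact: unitI_hausdorff|].
  rewrite (_ : (fun _ => _) = \pi_(Glob R Y) \o
    (fun p : X * I * I => (G (p.1.1, p.2), k p))); last first.
    by apply/funext => -[[x t] u]; exact: HE.
  move=> p; apply: continuous_comp; last exact: pi_continuous.
  apply: continuous_pair; last exact: ck.
  apply: (@continuous_comp _ _ _ (fun p : X * I * I => (p.1.1, p.2)) G);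
    last exact: cG.
  apply: continuous_pair; last exact: cvg_snd.
  by apply: continuous_comp; exact: cvg_fst.
exists H; split => // u.
apply: (@column_morphism _ (fun x => G (x, u)) (fun x t => k (x, t, u))) => //;
  last by move=> x; exact: km.
move=> z; apply: (@continuous_comp _ _ _ (fun z => (z, u)) H); last exact: cH.
by apply: continuous_pair; [exact: cvg_id|exact: cst_continuous].
Qed.

Lemma glob_mor_homotopic (g g' : continuousType X Y) :
  homotopic R g g' -> S_homotopic (glob_mor R g) (glob_mor R g').
Proof.
move=> [G [cG G0 G1 _]].
have [||x u||x u t t'|H [cH HE mH]] :=
  @column_homotopy G (fun p => p.1.2) => //.
  by move=> p; apply: continuous_comp; [exact: cvg_fst|exact: cvg_snd].
exists H; split => // z; rewrite [z]glob_ptE HE /= glob_mapE.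
  by rewrite G0.
by rewrite G1.
Qed.

(** This gives surjectivity on classes. *)
Lemma S_homotopic_glob_mor (f : glob_morphism R X Y) :
  exists g : continuousType X Y, S_homotopic (glob_mor R g) f.
Proof.
have [cf _ ef] := glob_morphismP f.
have cpt : continuous (fun p : X * I => f (glob_pt R p.1 p.2)).
  rewrite (_ : (fun _ => _) = f \o \pi_(Glob R X)); last first.
    by apply/funext => -[].
  by move=> p; apply: continuous_comp; [exact: pi_continuous|exact: cf].
have epath x : exec_path (fun t => f (glob_pt R x t)).
  exact: ef (column_exec_path x).
have [g cg fE] := exec_path_family_column cpt epath.
pose h x t := glob_height (f (glob_pt R x t)).
have {}fE x t : f (glob_pt R x t) = glob_pt R (g x) (h x t) by exact: fE.
have h0 x : h x unitI0 = unitI0.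
  by have [_ _ [y _ fy] _] := epath x; rewrite /h -fy glob_heightE.
have h1 x : h x unitI1 = unitI1.
  by have [_ _ _ [y _ fy]] := epath x; rewrite /h -fy glob_heightE.
have hm x t t' : unitI_val t <= unitI_val t' ->
    unitI_val (h x t) <= unitI_val (h x t').
  have [_ mf _ _] := epath x; move=> /mf[y [s [s' [ss' fs fs']]]].
  by rewrite /h fs fs' !glob_heightE.
pose k (p : X * I * I) : R :=
  (1 - unitI_val p.2) * unitI_val p.1.2 +
  unitI_val p.2 * unitI_val (h p.1.1 p.1.2).
have k01 p : 0 <= k p <= 1.
  have /andP[u0 u1] := unitI_itv p.2; have /andP[t0 t1] := unitI_itv p.1.2.
  have /andP[s0 s1] := unitI_itv (h p.1.1 p.1.2).
  have v0 : 0 <= 1 - unitI_val p.2 by rewrite subr_ge0.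
  (* For the upper bound, 1 is written as [(1 - u) + u] and compared termwise. *)
  rewrite addr_ge0 ?mulr_ge0//= -[leRHS](subrK (unitI_val p.2)).
  by rewrite lerD// ler_piMr.
have ck : continuous k.
  have cv : continuous (fun p : X * I * I => unitI_val p.2).
    move=> p; apply: continuous_comp; first exact: cvg_snd.
    exact: unitI_val_continuous.
  move=> p; apply: cvgD; apply: cvgM.
  - by apply: cvgB; [exact: cvg_cst|exact: cv].
  - apply: (@continuous_comp _ _ _ (fun p : X * I * I => p.1.2) unitI_val);
      last exact: unitI_val_continuous.
    by apply: continuous_comp; [exact: cvg_fst|exact: cvg_snd].
  - exact: cv.
  - apply: (@continuous_comp _ _ _ fst
      (fun q : X * I => unitI_val (h q.1 q.2))); first exact: cvg_fst.
    apply: (@continuous_comp _ _ _ (fun p : X * I => f (glob_pt R p.1 p.2))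
      (unitI_val \o glob_height)); first exact: cpt.
    by apply: continuous_comp;
      [exact: glob_height_continuous|exact: unitI_val_continuous].
have [|||||H [cH HE mH]] := @column_homotopy (g \o fst) (clamp \o k).
- by move=> p; apply: continuous_comp; [exact: cvg_fst|exact: cg].
- by move=> p; apply: continuous_comp; [exact: ck|exact: clamp_continuous].
- by move=> x u; rewrite /= /k /= h0 unitI0E !mulr0 addr0.
- by move=> x u; rewrite /= /k /= h1 unitI1E !mulr1 subrK.
- move=> x u t t' tt' /=; rewrite !clampE// /k /=.
  have /andP[u0 u1] := unitI_itv u.
  by rewrite lerD ?ler_wpM2l ?subr_ge0 ?hm.
pose gc : continuousType X Y :=
  HB.pack_for (continuousType X Y) g (isContinuous.Build _ _ g cg).
exists gc, H; split => // z; rewrite [z]glob_ptE HE /= ?glob_mapE ?fE;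
  congr glob_pt.
  apply: unitI_val_inj.
  by rewrite clampE// /k /= unitI0E subr0 mul1r mul0r addr0.
by apply: unitI_val_inj; rewrite clampE// /k /= unitI1E subrr mul0r mul1r add0r.
Qed.

(** This gives injectivity on classes. *)
Lemma S_homotopic_homotopic (g g' : continuousType X Y) :
  S_homotopic (glob_mor R g) (glob_mor R g') -> homotopic R g g'.
Proof.
move=> [H [cH H0 H1 mH]].
(* The coordinates are reordered so that [(x, u)] is the parameter and the height [t] is the time of
   the path. *)
pose F (p : X * I * I) := H (glob_pt R p.1.1 p.2, p.1.2).
have cF : continuous F.
  move=> p; apply: (@continuous_comp _ _ _
    (fun p : X * I * I => (glob_pt R p.1.1 p.2, p.1.2)) H); last exact: cH.
  apply: continuous_pair; last first.
    by apply: continuous_comp; [exact: cvg_fst|exact: cvg_snd].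
  apply: (@continuous_comp _ _ _ (fun p : X * I * I => (p.1.1, p.2)));
    last exact: pi_continuous.
  apply: continuous_pair; last exact: cvg_snd.
  by apply: continuous_comp; exact: cvg_fst.
have eF q : exec_path (fun t => F (q, t)).
  by have [_ _ eH] := mH q.2; exact: eH (column_exec_path q.1).
have [G cG FE] := exec_path_family_column cF eF.
(* Any height strictly between 0 and 1 would do: there [glob_base] recovers the true base. *)
have half : 0 < unitI_val (clamp 2^-1 : I) < 1.
  by have /andP[? ?] := half01 (R := R); rewrite clampE ?half01// !ltW.
have base u x (a : continuousType X Y) :
    (forall z, H (z, u) = glob_mor R a z) -> G (x, u) = a x.
  move=> Ha; have := FE (x, u) (clamp 2^-1); rewrite /F /= Ha /= !glob_mapE.
  rewrite glob_heightE => /(congr1 glob_base).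
  by rewrite !glob_baseE.
by exists G; split => // z; exact: base.
Qed.

End morphisms.

Theorem corollary5p8 (R : realType) (X Y : topologicalType)
    (cgX : compactly_generated X) (cgY : compactly_generated Y) :
  exists Phi : homotopy_class R X Y -> S_homotopy_class R X Y,
    (forall g : continuousType X Y,
       Phi (\pi_(homotopy_class R X Y) g) =
       \pi_(S_homotopy_class R X Y) (glob_mor R g)) /\
    bijective Phi.
Proof.
(* Defined on chosen representatives; [glob_mor_homotopic] makes the choice immaterial. *)
pose Phi (c : homotopy_class R X Y) : S_homotopy_class R X Y :=
  \pi_(S_homotopy_class R X Y) (glob_mor R (repr c)).
have PhiE g : Phi (\pi_(homotopy_class R X Y) g) =
    \pi_(S_homotopy_class R X Y) (glob_mor R g).
  apply/eqmodP/asboolP; apply: glob_mor_homotopic; apply/asboolP.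
  by apply/(@eqmodP _ (homotopic_equiv R X Y)); rewrite reprK.
have PhiI : injective Phi.
  move=> c d /eqmodP/asboolP/S_homotopic_homotopic cd.
  rewrite -[c]reprK -[d]reprK.
  exact/eqmodP/asboolP.
(* Surjectivity and choice give a right inverse, which injectivity makes two-sided. *)
have /choice[Psi PsiK] : forall d, exists c, Phi c = d.
  move=> d; have [g gd] := S_homotopic_glob_mor (repr d).
  exists (\pi_(homotopy_class R X Y) g); rewrite PhiE -[RHS]reprK.
  exact/eqmodP/asboolP.
by exists Phi; split => //; exists Psi => //; exact: inj_can_sym PsiK PhiI.
Qed.
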